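(* Let $n,d,N\ge 1$ be integers with $d\le n/2$ and $N\le\binom{\lfloor\sqrt{nd/2}\rfloor}{d}$, and let $f=\max\{r\in\mathbb Z:\ \binom{r}{d}\le N\}$. Let $\mathbf A$ be either $\mathbf A_{n,d}$ (uniform case) or $\bigcup_{k=1}^d\mathbf A_{n,k}$ (non-uniform case). (i) (Converse.) Let $z\ge 1$ be real, and let $\mathbf X\subseteq\mathbf A$ be random, containing each $\mathbf e\in\mathbf A$ independently with its own probability $\varphi_{\mathbf e}\in[\varphi_{\min},1]$, where in the uniform case $$\varphi_{\min}=\min\left\{\frac{15nN\left(\log N+\frac45\frac{\log(2n^z)}{n}\right)}{\binom nd},1\right\}$$ and in the non-uniform case $$\varphi_{\min}=\min\left\{\frac{13nN\left(\log N+\frac{12}{13}\frac{\log(2n^z)}{n}\right)}{\sum_{k=1}^d\binom nk},1\right\}.$$ Then, with probability at least $1-\frac1{n^z}$, $\mathbf X$ is such that the optimal maximum vertex footprint satisfies $\pi^\star_{\mathbf X}\ge\frac12\frac{n}{N^{1/d}}$ in the uniform case, and $\pi^\star_{\mathbf X}\ge\frac{n}{2\sqrt2\,N^{1/d}}$ in the non-uniform case. (ii) (Achievability.) For every $\mathbf X\subseteq\mathbf A$, the partition of $\mathbf X$ given by the IC design has maximum vertex footprint $\pi_{IC}$ satisfying: if $f\mid n$, then $$\pi_{IC}\le\frac{dn}{f},$$ and otherwise $$\pi_{IC}\le n-(f-d)\left(\left\lfloor\tfrac{n}{f+d}\right\rfloor+1\right)\le 2d\left(\left\lfloor\tfrac{n}{f+d}\right\rfloor+1\right).$$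 This guarantees $\pi_{IC}\le 4e\,\frac{n}{N^{1/d}}$, which is at most a factor $8e$ (uniform case), respectively $8\sqrt2\,e$ (non-uniform case), from the lower bound of (i).
   Context: $[n]=\{1,\dots,n\}$, and $\mathbf A_{n,k}$ is the set of all $k$-element subsets of $[n]$. $\log$ is the natural logarithm. **Partitions and footprint.** For $\mathbf X\subseteq\mathbf A$ (a hyperedge set), an $N$-edge partitioning of $\mathbf X$ is a tuple $(\mathbf\Phi_1,\dots,\mathbf\Phi_N)$ of pairwise disjoint (possibly empty) sets with union $\mathbf X$. Put $\alpha(\mathbf\Phi_b)=\{i\in[n]:\exists\,\mathbf e\in\mathbf\Phi_b,\ i\in\mathbf e\}$. The maximum vertex footprint of the partitioning is $\max_{b\in[N]}|\alpha(\mathbf\Phi_b)|$, and $\pi^\star_{\mathbf X}$ is the minimum of this quantity over all $N$-edge partitionings of $\mathbf X$. **IC (interweaved-cliques) design** for $(n,d,N)$. Let $f=\max\{r\in\mathbb Z:\binom rd\le N\}$ (so $f\ge d$) and $N'=\binom fd$. Let $s=n/f$ if $f\mid n$ and $s=\lfloor n/(f+d)\rfloor+1$ otherwise (under the assumptions here, $fs\le n$). Let $\mathcal F_i=\{(i-1)s+1,\dots,is\}$ for $i\in[f]$; the vertices $fs+1,\dots,n$ lie in no family. For $\mathbf e\subseteq[n]$ let $\mathcal B(\mathbf e)=\{j\in[f]:\mathbf e\cap\mathcal F_j\ne\emptyset\}$. Step A. For each $k$ (only $k=d$ in the uniform case; $k=1,\dots,d$ in the non-uniform case), $\mathbf A_{n,k}$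 is split into groups $\widetilde{\mathbf\Phi}^k_\sigma$ indexed by the $d$-subsets $\sigma$ of $[f]$, as follows. For each $\mathcal I\subseteq[f]$ with $|\mathcal I|\le k$, list $\mathbf Q^k_{\mathcal I}=\{\mathbf e\in\mathbf A_{n,k}:\mathcal B(\mathbf e)=\mathcal I\}$ in lexicographic order. List the $d$-subsets $\sigma\supseteq\mathcal I$ of $[f]$ in lexicographic order as $\sigma_1,\dots,\sigma_m$, with $m=\binom{f-|\mathcal I|}{d-|\mathcal I|}$. Write $|\mathbf Q^k_{\mathcal I}|=qm+r$ with $0\le r<m$. Cut the list of $\mathbf Q^k_{\mathcal I}$ into $m$ consecutive blocks, the first $r$ of size $q+1$ and the others of size $q$, and assign the $j$-th block to $\sigma_j$. $\widetilde{\mathbf\Phi}^k_\sigma$ is the union of all blocks assigned to $\sigma$ over all such $\mathcal I$. Step B. Order the $N'$ indices $\sigma$ lexicographically and rename the groups $\widetilde{\mathbf\Phi}^k_1,\dots,\widetilde{\mathbf\Phi}^k_{N'}$. Let $r=N\bmod N'$, and let $s_b=\lceil N/N'\rceil$ for $b\le r$ and $s_b=\lfloor N/N'\rfloor$ for $r<b\le N'$. Split the old group $\widetilde{\mathbf\Phi}^k_b$ into $s_b$ sub-parts numbered $0,\dots,s_b-1$ by going through it in lexicographic order in a round-robin manner. Sub-part $b'$ of old group $b$ becomes the new group with index $b+b'N'$. This gives $N$ groups $\widetilde{\mathbf\Phi}^k_1,\dots,\widetilde{\mathbf\Phi}^k_N$ for each $k$. Set $\widetilde{\mathbf\Phi}_b=\widetilde{\mathbf\Phi}^d_b$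 in the uniform case and $\widetilde{\mathbf\Phi}_b=\bigcup_{k=1}^d\widetilde{\mathbf\Phi}^k_b$ in the non-uniform case; these partition $\mathbf A$. Step C. For $\mathbf X\subseteq\mathbf A$, the IC partition of $\mathbf X$ is $\mathbf\Phi_b=\widetilde{\mathbf\Phi}_b\cap\mathbf X$, $b\in[N]$, and $\pi_{IC}=\max_{b}|\alpha(\mathbf\Phi_b)|$.
   Formalization: The converse (i) is proved for N ≥ 2 only; for N = 1 it is false as stated: with d = z = 1, n = 512 and all φ_e = φ_min, the footprint is |X|, with mean about 83, far below n/2 = 256. Part (ii) is proved for all N ≥ 1. *)

(* Defs.v *)
From HB Require Import structures.
From mathcomp Require Import all_boot all_order all_algebra.
From mathcomp Require Import zify.
From mathcomp Require Import reals sequences exp.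

Set Implicit Arguments.
Unset Strict Implicit.
Unset Printing Implicit Defensive.

Import Order.TTheory GRing.Theory Num.Theory.

(* The vertex set [n] is 'I_n, and all indices start from 0 instead of 1. *)

Inductive setting := Uniform | NonUniform.

Definition ksubsets (n k : nat) : {set {set 'I_n}} :=
  [set e : {set 'I_n} | #|e| == k].

Definition hyperedges (c : setting) (n d : nat) : {set {set 'I_n}} :=
  match c with
  | Uniform => ksubsets n d
  | NonUniform => \bigcup_(1 <= k < d.+1) ksubsets n k
  end.

Section Partitions.
Context {n N : nat}.
Implicit Types (X : {set {set 'I_n}}) (Phi : {ffun 'I_N -> {set {set 'I_n}}}).

Definition edge_partitioning X Phi : bool :=
  [forall b, forall b', (b != b') ==> [disjoint Phi b & Phi b']]
  && (\bigcup_b Phi b == X).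

Definition max_footprint Phi : nat := \max_b #|cover (Phi b)|.

End Partitions.

(* A footprint is at most n, so the default value n of the iterated minimum
   is harmless. *)
Definition opt_footprint (n N : nat) (X : {set {set 'I_n}}) : nat :=
  \big[minn/n]_(Phi : {ffun 'I_N -> {set {set 'I_n}}} | edge_partitioning X Phi)
    max_footprint Phi.

Lemma opt_footprint_le (n N : nat) (X : {set {set 'I_n}})
    (Phi : {ffun 'I_N -> {set {set 'I_n}}}) :
  edge_partitioning X Phi -> opt_footprint N X <= max_footprint Phi.
Proof.
move=> XPhi; rewrite /opt_footprint.
elim: (index_enum _) (mem_index_enum Phi) => // P r IHr.
rewrite inE big_cons => /predU1P[<- | /IHr le_r]; first by rewrite XPhi geq_minl.
by case: ifP => // _; rewrite geq_min le_r orbT.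
Qed.

Lemma opt_footprint_attained (n N : nat) (X : {set {set 'I_n}}) : 0 < N ->
  exists2 Phi : {ffun 'I_N -> {set {set 'I_n}}},
    edge_partitioning X Phi & opt_footprint N X = max_footprint Phi.
Proof.
move=> N_gt0; pose b0 := Ordinal N_gt0.
pose P0 : {ffun 'I_N -> {set {set 'I_n}}} :=
  [ffun b => if b == b0 then X else set0].
have P0X : edge_partitioning X P0.
  apply/andP; split.
    apply/forallP => b; apply/forallP => b'; apply/implyP; rewrite !ffunE.
    case: (eqVneq b b0) => [->|_ _]; last by rewrite -setI_eq0 set0I.
    by rewrite eq_sym => /negPf ->; rewrite -setI_eq0 setI0.
  rewrite (bigD1 b0) //= ffunE eqxx big1 ?setU0 // => b /negPf bb0.
  by rewrite ffunE bb0.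
have leP0 : max_footprint P0 <= n.
  by apply/bigmax_leqP => b _; rewrite -[leqRHS]card_ord max_card.
case: (arg_minnP max_footprint P0X) => Phi XPhi minPhi.
exists Phi => //; apply/eqP; rewrite eqn_leq opt_footprint_le //=.
rewrite /opt_footprint; elim/big_ind: _ => //=.
  exact: leq_trans (minPhi _ P0X) leP0.
by move=> x y ax ay; rewrite leq_min ax.
Qed.

(* The bound r < N + d + 1 loses nothing: see IC_f_max. *)
Definition IC_f (d N : nat) : nat := \max_(r < (N + d).+1 | 'C(r, d) <= N) r.

Lemma IC_fP (d N : nat) : 0 < d -> 'C(IC_f d N, d) <= N.
Proof.
move=> d_gt0; rewrite /IC_f; elim/big_ind: _ => //.
  by rewrite bin_small.
by move=> x y; rewrite /maxn; case: ifP.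
Qed.

Lemma IC_f_max (d N r : nat) : 0 < d -> 'C(r, d) <= N -> r <= IC_f d N.
Proof.
move=> d_gt0 rN; have ltr : r < (N + d).+1.
  have binl m : m < 'C(m + d, d).
    elim: m => [|m IHm]; first by rewrite binn.
    rewrite addSn; case: d d_gt0 rN IHm => // d _ _ IHm.
    rewrite binS -[m.+2]addn1 leq_add // bin_gt0; lia.
  case: (leqP r d) => [rd | /ltnW dr]; first by lia.
  by have := binl (r - d); rewrite subnK //; lia.
exact: (@leq_bigmax_cond _ (fun i : 'I_(N + d).+1 => 'C(i, d) <= N) _ (Ordinal ltr)).
Qed.

Definition IC_s (n d N : nat) : nat :=
  let f := IC_f d N in
  if f %| n then n %/ f else (n %/ (f + d)).+1.

(* Lexicographic comparison of sets written as increasing sequences; enum A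
   lists A in increasing order. *)
Definition lex_le (m : nat) : rel {set 'I_m} :=
  fun A B => ((enum A : seqlexi 'I_m) <= (enum B : seqlexi 'I_m))%O.

Definition lex_enum (m : nat) (S : {set {set 'I_m}}) : seq {set 'I_m} :=
  sort (@lex_le m) (enum S).

Definition cut (T : Type) (m : nat) (L : seq T) : seq (seq T) :=
  let q := size L %/ m in
  let r := size L %% m in
  reshape (nseq r q.+1 ++ nseq (m - r) q) L.

Section InterweavedCliques.
Variables n d N : nat.

Let f := IC_f d N.
Let s := IC_s n d N.

Definition IC_family (j : 'I_f) : {set 'I_n} :=
  [set v : 'I_n | j * s <= v < j.+1 * s].

Definition IC_trace (e : {set 'I_n}) : {set 'I_f} :=
  [set j | e :&: IC_family j != set0].

Definition IC_Q (k : nat) (I : {set 'I_f}) : {set {set 'I_n}} :=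
  [set e in ksubsets n k | IC_trace e == I].

Definition IC_supersets (I : {set 'I_f}) : seq {set 'I_f} :=
  lex_enum [set sigma in ksubsets f d | I \subset sigma].

Definition IC_block (k : nat) (I sigma : {set 'I_f}) : {set {set 'I_n}} :=
  let L := lex_enum (IC_Q k I) in
  let S := IC_supersets I in
  [set e in nth [::] (cut (size S) L) (index sigma S)].

Definition IC_old_group (k : nat) (sigma : {set 'I_f}) : {set {set 'I_n}} :=
  \bigcup_(I : {set 'I_f} | (#|I| <= k) && (I \subset sigma)) IC_block k I sigma.

(* New group c is sub-part b' = c %/ N' of old group b = c %% N', since
   c = b + b' * N'.  Old group b is dealt into ceil(N / N') sub-parts if
   b < N %% N', and into floor(N / N') otherwise. *)
Definition IC_new_group (k : nat) (c : 'I_N) : {set {set 'I_n}} :=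
  let N' := 'C(f, d) in
  let b := c %% N' in
  let G := IC_old_group k (nth set0 (lex_enum (ksubsets f d)) b) in
  let s_b := N %/ N' + (b < N %% N') in
  [set e in G | index e (lex_enum G) %% s_b == c %/ N'].

Definition IC_group (c : setting) (b : 'I_N) : {set {set 'I_n}} :=
  match c with
  | Uniform => IC_new_group d b
  | NonUniform => \bigcup_(1 <= k < d.+1) IC_new_group k b
  end.

Definition IC_partition (c : setting) (X : {set {set 'I_n}}) :
    {ffun 'I_N -> {set {set 'I_n}}} :=
  [ffun b => IC_group c b :&: X].

End InterweavedCliques.

Local Open Scope ring_scope.

(* Probability of the event E for a random subset X of A that contains each e
   in A independently with probability phi e. *)
Definition random_subset_prob (R : realType) (T : finType) (A : {set T})
    (phi : T -> R) (E : pred {set T}) : R :=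
  \sum_(X : {set T} | (X \subset A) && E X)
    (\prod_(e in X) phi e * \prod_(e in A :\: X) (1 - phi e)).

Definition phi_min (R : realType) (c : setting) (n d N : nat) (z : R) : R :=
  match c with
  | Uniform =>
      Num.min (15 * n%:R * N%:R
               * (ln N%:R + 4 / 5 * (ln (2 * n%:R `^ z) / n%:R))
               / 'C(n, d)%:R) 1
  | NonUniform =>
      Num.min (13 * n%:R * N%:R
               * (ln N%:R + 12 / 13 * (ln (2 * n%:R `^ z) / n%:R))
               / (\sum_(1 <= k < d.+1) 'C(n, k))%:R) 1
  end.

Definition footprint_lower_bound (R : realType) (c : setting) (n d N : nat) : R :=
  match c with
  | Uniform => 1 / 2 * (n%:R / N%:R `^ (1 / d%:R))
  | NonUniform => n%:R / (2 * Num.sqrt 2 * N%:R `^ (1 / d%:R))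
  end.

Definition optimality_factor (R : realType) (c : setting) : R :=
  match c with
  | Uniform => 8 * expR 1
  | NonUniform => 8 * Num.sqrt 2 * expR 1
  end.

(* Main.v *)
(* Converse.  If the footprint of X is below the threshold, then some N-tuple W
   of vertex sets of subthreshold size has every edge of X inside a member of W.
   Each such W leaves at least a sixth of the hyperedges uncovered, so X avoids
   all the uncovered ones with probability at most exp(- phi_min |A| / 6), which
   beats the union bound over the at most 2 ^ (n N) tuples since N >= 2.
   Achievability.  The edges of one group only meet the families of a single
   d-subset sigma of [f], so their footprint avoids the (f - d) s vertices of
   the other families; N < 'C(f + 1, d) <= (e (f + 1) / d) ^ d then converts
   this bound into one in terms of N. *)
Require Import Defs.
From mathcomp Require Import all_boot all_order all_algebra.
From mathcomp Require Import zify ring lra.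
From mathcomp Require Import reals sequences exp.

Set Implicit Arguments.
Unset Strict Implicit.
Unset Printing Implicit Defensive.

Import Order.TTheory GRing.Theory Num.Theory.
Local Open Scope ring_scope.

(** * Binomial coefficients *)

Section BinomialBounds.
Local Open Scope nat_scope.

(** Factor by factor [(w - i) / (n - i) <= w / n], so a [w]-subset contains at most a fraction
    [(w / n) ^ k] of all [k]-sets. *)
Lemma leq_bin_ratio w n k : w <= n -> 'C(w, k) * n ^ k <= 'C(n, k) * w ^ k.
Proof.
move=> wn; suff: w ^_ k * n ^ k <= n ^_ k * w ^ k.
  by rewrite -!bin_ffact !(mulnAC _ k`!) leq_mul2r; have := fact_gt0 k; lia.
elim: k => // k IHk; rewrite !ffactnSr !expnSr.
have step : (w - k) * n <= (n - k) * w by nia.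
by have := leq_mul IHk step; congr (_ <= _); lia.
Qed.

Lemma ffact_leq_exp m k : m ^_ k <= m ^ k.
Proof. by elim: k => // k IHk; rewrite ffactnSr expnSr leq_mul ?leq_subr. Qed.

Lemma leq_bin_half n k l : k <= l -> 2 * l <= n -> 'C(n, k) <= 'C(n, l).
Proof.
elim: l => [|l IHl]; first by rewrite leqn0 => /eqP->.
rewrite leq_eqVlt => /predU1P[-> //|kl] ln.
apply: leq_trans (IHl _ _) _; [lia|lia|].
rewrite -(leq_pmul2l (ltn0Sn l)) mul_bin_left leq_mul2r; lia.
Qed.

(** In this range consecutive layers grow by a factor of at least [3 / 2], so a geometric series of
    ratio [2 / 3] bounds the sum. *)
Lemma sum_bin_leq3 n d : 5 * d <= 2 * n ->
  \sum_(1 <= k < d.+1) 'C(n, k) <= 3 * 'C(n, d).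
Proof.
elim: d => [|d IHd] dn; first by rewrite big_geq.
rewrite big_nat_recr //=; have {}IHd := IHd ltac:(lia).
have := mul_bin_left n d.
have : 3 * d.+1 * 'C(n, d) <= 2 * (n - d) * 'C(n, d) by rewrite leq_mul2r; lia.
nia.
Qed.

(** The reflection [k -> d - k] injects the layers below [d / 2] into layers above it that are at
    least as large. *)
Lemma sum_bin_upper_half n d : 2 * d <= n ->
  \sum_(1 <= k < d.+1) 'C(n, k) <=
    2 * \sum_(1 <= k < d.+1 | d <= 2 * k) 'C(n, k).
Proof.
move=> dn; rewrite (bigID (fun k => d <= 2 * k)) /= mul2n -addnn leq_add2l.
case: d dn => [|d] dn; first by rewrite !big_geq.
rewrite big_mkcond [leqRHS]big_mkcond /= !(@big_nat_recr _ _ _ d.+1) //=.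
rewrite ifF ?addn0; last by lia.
apply: leq_trans (leq_addr _ _); rewrite big_nat_rev /= big_nat [leqRHS]big_nat.
apply: leq_sum => k /andP[k_gt0 kd].
case: ifP => // dk; rewrite ifT; last by lia.
by apply: leq_bin_half; lia.
Qed.

Lemma bin_leq_exp2 n k : 'C(n, k) <= 2 ^ n.
Proof.
elim: n k => [|n IHn] [|k]; rewrite ?bin0 ?expn_gt0 //.
by rewrite binS expnS mul2n -addnn leq_add.
Qed.

End BinomialBounds.

(** * Random subsets *)

Section RandomSubset.
Context {R : realType} {T : finType}.
Implicit Types (A B U X : {set T}) (phi : T -> R) (E : pred {set T}).

(** Expand [\prod_e (F e + G e) = 1] distributively: the values 0 and 1 outside [A] kill every set
    not included in [A] and leave the other weights unchanged. *)
Lemma random_subset_prob_total A phi :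
  random_subset_prob A phi predT = 1.
Proof.
rewrite /random_subset_prob.
pose F e := if e \in A then phi e else 0.
pose G e := if e \in A then 1 - phi e else 1.
have : \prod_e (F e + G e) = 1.
  by apply: big1 => e _; rewrite /F /G; case: ifP; rewrite ?add0r // addrC subrK.
rewrite bigA_distr => tot; rewrite -[RHS]tot.
rewrite [RHS](bigID (fun X => X \subset A)) /= [X in _ = _ + X]big1 ?addr0.
  apply: eq_big => [X|X /[!andbT] XA]; first by rewrite andbT.
  rewrite [RHS](bigID (mem X)) /=; congr (_ * _).
    by apply: eq_bigr => e eX; rewrite eX /F (subsetP XA).
  rewrite [LHS](eq_bigl (fun e => (e \notin X) && (e \in A))); last first.
    by move=> e; rewrite inE.
  by rewrite big_mkcondr /=; apply: eq_bigr => e /negPf ->; rewrite /G.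
move=> X /subsetPn[e eX eA].
by rewrite (bigD1 e) //= eX /F (negPf eA) mul0r.
Qed.

Lemma random_subset_prob_compl A phi E :
  random_subset_prob A phi E = 1 - random_subset_prob A phi (predC E).
Proof.
apply/eqP; rewrite -[X in _ == X - _](random_subset_prob_total A phi).
rewrite /random_subset_prob eq_sym subr_eq (bigID E) /=; apply/eqP.
by congr (_ + _); apply: eq_bigl => X; rewrite andbT.
Qed.

(** For [X] disjoint from [U] the weight splits into the product over [U] and the weight of [X] as a
    random subset of [A :\: U]; the latter weights sum to 1. *)
Lemma random_subset_prob_disjoint A U phi : U \subset A ->
  random_subset_prob A phi (fun X => [disjoint X & U]) =
    \prod_(e in U) (1 - phi e).
Proof.
move=> UA; rewrite -[RHS]mulr1 -[X in _ = _ * X](random_subset_prob_total (A :\: U) phi).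
rewrite /random_subset_prob big_distrr /=; apply: eq_big => [X|X /andP[XA XU]].
  by rewrite subsetD andbT.
rewrite mulrCA; congr (_ * _).
rewrite [LHS](bigID (mem U)) /=; congr (_ * _); apply: eq_bigl => e.
  rewrite !inE; case eU: (e \in U); last by rewrite andbF.
  by rewrite (subsetP UA _ eU) (disjointFl XU).
by rewrite !inE; case: (e \in X) (e \in A) (e \in U) => [] [] [].
Qed.

Section UnionBound.
Variables (A : {set T}) (phi : T -> R).
Hypothesis phi01 : forall e, e \in A -> 0 <= phi e <= 1.

Lemma random_subset_weight_ge0 X : X \subset A ->
  0 <= \prod_(e in X) phi e * \prod_(e in A :\: X) (1 - phi e).
Proof.
move=> XA; apply: mulr_ge0; apply: prodr_ge0 => e.
  by move=> /(subsetP XA)/phi01/andP[].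
by rewrite inE => /andP[_ /phi01/andP[_]]; rewrite subr_ge0.
Qed.

Lemma random_subset_union_bound (I : finType) (P : pred I) E (F : I -> pred {set T}) :
  (forall X, X \subset A -> E X -> exists2 i, P i & F i X) ->
  random_subset_prob A phi E <= \sum_(i | P i) random_subset_prob A phi (F i).
Proof.
move=> EF; rewrite /random_subset_prob
  (exchange_big_dep (fun X => X \subset A)) /= => [|i X _ /andP[XA _] //].
rewrite big_mkcondr /=; apply: ler_sum => X XA.
have w_ge0 := random_subset_weight_ge0 XA.
case: ifP => [/(EF _ XA)[i Pi FiX]|_]; last exact: sumr_ge0.
by rewrite (bigD1 i) /= ?Pi ?XA // lerDl sumr_ge0.
Qed.
End UnionBound.
End RandomSubset.

(** * Converse *)

Section Hyperedges.
Local Open Scope nat_scope.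
Variable n : nat.
Implicit Types (k d : nat) (e : {set 'I_n}) (U : {set {set 'I_n}}).

Lemma mem_hyperedges_NonUniform d e :
  (e \in hyperedges NonUniform n d) = (0 < #|e| <= d).
Proof.
rewrite /hyperedges; elim: d => [|d IHd].
  by rewrite big_geq // inE leqn0 lt0n andNb.
rewrite big_nat_recr //= in_setU IHd inE; set m := #|_|; lia.
Qed.

Lemma card_hyperedges_NonUniformI d U :
  #|hyperedges NonUniform n d :&: U| =
    \sum_(1 <= k < d.+1) #|ksubsets n k :&: U|.
Proof.
elim: d => [|d IHd]; first by rewrite /= !big_geq // set0I cards0.
rewrite big_nat_recr //= -IHd -cardsUI.
have -> : hyperedges NonUniform n d :&: U :&: (ksubsets n d.+1 :&: U) = set0.
  apply/setP => e; rewrite in_set0 !in_setI mem_hyperedges_NonUniform inE.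
  by set m := #|_|; lia.
rewrite cards0 addn0 -setIUl /=.
by rewrite [in LHS]big_nat_recr.
Qed.

Lemma card_ksubsets k : #|ksubsets n k| = 'C(n, k).
Proof. by rewrite card_draws card_ord. Qed.

Lemma card_hyperedges c d : #|hyperedges c n d| =
  if c is Uniform then 'C(n, d) else \sum_(1 <= k < d.+1) 'C(n, k).
Proof.
case: c => /=; first exact: card_ksubsets.
have := card_hyperedges_NonUniformI d setT; rewrite setIT => ->.
by apply: eq_bigr => k _; rewrite setIT card_ksubsets.
Qed.

Section Uncovered.
Context {N : nat}.
Implicit Type W : {ffun 'I_N -> {set 'I_n}}.

Definition uncovered W : {set {set 'I_n}} :=
  [set e : {set 'I_n} | [forall b, ~~ (e \subset W b)]].

(** Each [W b] contains at most a fraction [1 / (2 N)] of the layer, so all [N] of them cover at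
    most half of it. *)
Lemma card_uncovered_layer k W :
    (forall b, 2 * N * 'C(#|W b|, k) <= 'C(n, k)) ->
  'C(n, k) <= 2 * #|ksubsets n k :&: uncovered W|.
Proof.
move=> smallW; pose D b := [set e : {set 'I_n} | e \subset W b & #|e| == k].
have : ksubsets n k \subset (ksubsets n k :&: uncovered W) :|: \bigcup_b D b.
  apply/subsetP => e ek; rewrite in_setU in_setI ek /= orbC -implyNb.
  apply/implyP => eD; rewrite inE; apply/forallP => b.
  apply: contra eD => eW; apply/bigcupP; exists b => //.
  by move: ek; rewrite !inE eW.
move=> /subset_leq_card; rewrite card_ksubsets => /leq_trans/(_ (leq_card_setU _ _)).
set u := #|_ :&: _|; set v := #|\bigcup_b _| => le_uv.
have le_v : v <= \sum_b #|D b|.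
  rewrite /v; elim/big_ind2: _ => [|x1 x2 y1 y2 le1 le2|//].
    by rewrite cards0.
  exact: leq_trans (leq_card_setU _ _) (leq_add le1 le2).
have le_sum : N * (2 * \sum_b #|D b|) <= N * 'C(n, k).
  rewrite mulnCA mulnA big_distrr /=.
  apply: (@leq_trans (\sum_(b < N) 'C(n, k))).
    by apply: leq_sum => b _; rewrite cards_draws.
  by rewrite sum_nat_const card_ord.
(* For [N = 0] the factor [N] cannot be cancelled, but then the sum is empty. *)
have [N0|N_gt0] := posnP N; last by rewrite leq_pmul2l // in le_sum; lia.
suff S0 : \sum_b #|D b| = 0 by lia.
by apply: big1 => b; have := ltn_ord b; lia.
Qed.

(** The last hypothesis is [w <= n / (2 N^(1/d))] with the root cleared; it yields [(w / n) ^ d <= 1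
    / (2 ^ d N) <= 1 / (2 N)]. *)
Lemma footprint_uniform_bin d w : 0 < n -> 0 < d -> w <= n -> (2 * w) ^ d * N <= n ^ d ->
  2 * N * 'C(w, d) <= 'C(n, d).
Proof.
move=> n_gt0 d_gt0 wn w_lt; rewrite -(@leq_pmul2r (n ^ d)) ?expn_gt0 ?n_gt0 //.
rewrite -mulnA; apply: leq_trans (leq_mul (leqnn _) (leq_bin_ratio _ wn)) _.
rewrite mulnCA leq_mul2l; apply/orP; right; apply: leq_trans w_lt.
rewrite expnMn mulnAC leq_mul // leq_mul //.
by rewrite -[leqLHS](expn1 2) leq_exp2l.
Qed.

(** Since [4 k >= 2 d], one gets [(w / n) ^ (4 k) <= (w / n) ^ (2 d) <= 1 / (8 ^ d N ^ 2) <= 1 / (2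
    N) ^ 4]; the fourth power keeps all exponents integral. *)
Lemma footprint_nonuniform_bin d w k : 0 < n -> 16 * N ^ 2 <= 8 ^ d -> d <= 2 * k ->
  w <= n -> (8 * w ^ 2) ^ d * N ^ 2 <= (n ^ 2) ^ d ->
  2 * N * 'C(w, k) <= 'C(n, k).
Proof.
move=> n_gt0 N_small dk wn w_lt; rewrite -(@leq_pmul2r (n ^ k)) ?expn_gt0 ?n_gt0 //.
rewrite -mulnA; apply: leq_trans (leq_mul (leqnn _) (leq_bin_ratio _ wn)) _.
rewrite mulnCA leq_mul2l; apply/orP; right.
rewrite -(@leq_exp2r _ _ 4) // -expnM.
have -> : (2 * N * w ^ k) ^ 4 = 16 * N ^ 2 * (N ^ 2 * w ^ (k * 4)).
  by rewrite !expnMn -expnM (_ : N ^ 4 = N ^ 2 * N ^ 2) -?expnD // !mulnA.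
have -> : k * 4 = 2 * d + (k * 4 - 2 * d) by lia.
rewrite (expnD w) (expnD n) (expnM n) (mulnA (N ^ 2)) (mulnA (16 * N ^ 2)).
apply: leq_mul; last by case: (k * 4 - 2 * d) => // m; rewrite leq_exp2r.
rewrite (mulnC (N ^ 2)) (mulnA (16 * N ^ 2)); apply: leq_trans w_lt.
by rewrite expnMn -(expnM w) leq_mul // leq_mul.
Qed.

Lemma card_uncovered_Uniform d W : 0 < n -> 0 < d ->
    (forall b, (2 * #|W b|) ^ d * N <= n ^ d) ->
  #|hyperedges Uniform n d| <= 2 * #|hyperedges Uniform n d :&: uncovered W|.
Proof.
move=> n_gt0 d_gt0 smallW; rewrite card_hyperedges; apply: card_uncovered_layer => b.
by apply: footprint_uniform_bin => //; rewrite -[leqRHS]card_ord max_card.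
Qed.

Lemma card_uncovered_NonUniform d M W : 1 < N -> 0 < d -> 2 * d <= n ->
    2 * M ^ 2 <= n * d -> N <= 'C(M, d) ->
    (forall b, (8 * #|W b| ^ 2) ^ d * N ^ 2 <= (n ^ 2) ^ d) ->
  #|hyperedges NonUniform n d| <=
    6 * #|hyperedges NonUniform n d :&: uncovered W|.
Proof.
move=> N_gt1 d_gt0 d_le M_le N_le smallW; rewrite card_hyperedges card_hyperedges_NonUniformI.
have n_gt0 : 0 < n by lia.
have leWn b : #|W b| <= n by rewrite -[leqRHS]card_ord max_card.
(* For n >= 5d/2 the top layer is a constant fraction of all hyperedges.
   Otherwise N <= 2 ^ M with M close to d, so that N is small enough for every
   layer of size at least d/2 to be half uncovered. *)
have [dn | dn] := leqP (5 * d) (2 * n).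
  apply: leq_trans (sum_bin_leq3 dn) _; rewrite big_nat_recr //=.
  have : 'C(n, d) <= 2 * #|ksubsets n d :&: uncovered W|.
    apply: card_uncovered_layer => b; apply: footprint_uniform_bin => //.
    (* The non-uniform threshold lies below the uniform one: after squaring, the constants compare
       as [4 <= 8]. *)
    have sqX m : (m ^ d) ^ 2 = (m ^ 2) ^ d by rewrite -!expnM mulnC.
    rewrite -(@leq_exp2r _ _ 2) // sqX; apply: leq_trans (smallW b).
    by rewrite expnMn sqX leq_mul // leq_exp2r // expnMn leq_mul.
  by set u := #|ksubsets n d :&: _|; set v := bigop _ _ _; lia.
(* From [2 * M ^ 2 <= n * d] and [2 * n < 5 * d] one gets [M < (sqrt 5 / 2) d], and
   [sqrt 5 / 2 < 9 / 8]. *)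
have M8 : 8 * M <= 9 * d by nia.
have dM : d < M.
  by rewrite ltnNge; apply: contraL N_gt1; rewrite leq_eqVlt => /predU1P[E|lt];
    rewrite -leqNgt (leq_trans N_le) // ?E ?binn ?bin_small.
(* [d < M <= 9 d / 8] forces [d >= 8], hence [4 + 2 M <= 3 d]. *)
have N_small : 16 * N ^ 2 <= 8 ^ d.
  apply: (@leq_trans (2 ^ (4 + M * 2))).
    by rewrite expnD leq_mul // expnM leq_exp2r // (leq_trans N_le) ?bin_leq_exp2.
  by rewrite (_ : 8 = 2 ^ 3) // -expnM leq_exp2l //; lia.
apply: leq_trans (sum_bin_upper_half d_le) _.
apply: (@leq_trans (2 * \sum_(1 <= k < d.+1 | d <= 2 * k) 2 * #|ksubsets n k :&: uncovered W|)).
  apply: leq_mul => //; apply: leq_sum => k dk; apply: card_uncovered_layer => b.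
  by apply: (footprint_nonuniform_bin (d := d)).
rewrite -big_distrr /= mulnA leq_mul // [leqRHS](bigID (fun k => d <= 2 * k)) /=.
exact: leq_addr.
Qed.

End Uncovered.
End Hyperedges.

(** * From the counting bound to the probability estimate *)

Section Converse.
Context {R : realType}.

Lemma powR_inv_natK (x : R) (d : nat) : (0 < d)%N -> 0 <= x ->
  (x `^ (1 / d%:R)) ^+ d = x.
Proof.
move=> d_gt0 x_ge0; rewrite -powR_mulrn ?powR_ge0 // -powRrM mul1r mulVf ?powRr1 //.
by rewrite pnatr_eq0 -lt0n.
Qed.

Variables (n d N : nat).
Hypotheses (n_gt0 : (0 < n)%N) (d_gt0 : (0 < d)%N).

Lemma lt_footprint_Uniform w : (0 < N)%N ->
  w%:R < footprint_lower_bound R Uniform n d N -> ((2 * w) ^ d * N <= n ^ d)%N.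
Proof.
move=> N_gt0 /=; set y := _ `^ _ => w_lt.
have y_gt0 : 0 < y by rewrite powR_gt0 ?ltr0n.
have yd : y ^+ d = N%:R by apply: powR_inv_natK.
rewrite -(ler_nat R) natrM !natrX -yd -exprMn; apply: lerXn2r.
- by rewrite nnegrE mulr_ge0 // ltW.
- by rewrite nnegrE.
rewrite -ler_pdivlMr // natrM; lra.
Qed.

Lemma lt_footprint_NonUniform w : (0 < N)%N ->
  w%:R < footprint_lower_bound R NonUniform n d N ->
  ((8 * w ^ 2) ^ d * N ^ 2 <= (n ^ 2) ^ d)%N.
Proof.
move=> N_gt0 /=; set y := _ `^ _ => w_lt.
have y_gt0 : 0 < y by rewrite powR_gt0 ?ltr0n.
have yd : y ^+ d = N%:R by apply: powR_inv_natK.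
have s_gt0 : 0 < Num.sqrt 2 :> R by rewrite sqrtr_gt0.
have s2 : Num.sqrt 2 ^+ 2 = 2 :> R by rewrite sqr_sqrtr.
rewrite -(ler_nat R) natrM !natrX -yd (exprAC y) -exprMn; apply: lerXn2r.
- by rewrite nnegrE mulr_ge0 ?exprn_ge0 // ltW.
- by rewrite nnegrE exprn_ge0.
rewrite natrM natrX.
have -> : 8 * w%:R ^+ 2 * y ^+ 2 = (w%:R * (2 * Num.sqrt 2 * y)) ^+ 2.
  by rewrite !exprMn s2; ring.
apply: lerXn2r; rewrite ?nnegrE ?mulr_ge0 // ?ltW //.
by rewrite -ltr_pdivlMr ?mulr_gt0.
Qed.

(** The constant 6 comes from the non-uniform setting with [n >= 5 d / 2]: the top layer holds at
    least a third of all hyperedges, and at least half of it is uncovered. *)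
Lemma card_uncovered c M (W : {ffun 'I_N -> {set 'I_n}}) :
    (1 < N)%N -> (2 * d <= n)%N -> (2 * M ^ 2 <= n * d)%N -> (N <= 'C(M, d))%N ->
    (forall b, #|W b|%:R < footprint_lower_bound R c n d N) ->
  (#|hyperedges c n d| <= 6 * #|hyperedges c n d :&: uncovered W|)%N.
Proof.
move=> N_gt1 d_le M_le N_le smallW; have N_gt0 := ltnW N_gt1.
case: c smallW => smallW; last first.
  by apply: card_uncovered_NonUniform M_le N_le _ => // b;
    apply: lt_footprint_NonUniform.
apply: leq_trans (@card_uncovered_Uniform _ _ _ W _ _ _) _ => // [b|].
  exact: lt_footprint_Uniform.
by rewrite leq_mul2r orbT.
Qed.

(** One bound serves both settings: [15 * (4 / 5) = 13 * (12 / 13) = 12], and 15 is weakened to 13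
    in front of [ln N]. *)
Lemma phi_min_lower_bound c (z : R) : (0 < N)%N -> 1 <= z ->
  Num.min ((13 * n%:R * N%:R * ln N%:R + 12 * N%:R * (ln 2 + z * ln n%:R))
    / #|hyperedges c n d|%:R) 1 <= phi_min c n d N z.
Proof.
move=> N_gt0 z_ge1.
have n_neq0 : n%:R != 0 :> R by rewrite pnatr_eq0 -lt0n.
have -> : ln 2 + z * ln n%:R = ln (2 * n%:R `^ z) :> R.
  by rewrite lnM ?posrE ?powR_gt0 ?ltr0n // ln_powR.
have lnN : 0 <= ln N%:R :> R by rewrite ln_ge0 // ler1n.
have nNlnN : 0 <= n%:R * N%:R * ln N%:R :> R by rewrite !mulr_ge0.
rewrite /phi_min card_hyperedges; set L := ln (2 * _).
have mono (a b m : R) : 0 <= m -> a <= b -> Num.min (a / m) 1 <= Num.min (b / m) 1.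
  move=> m_ge0 ab; rewrite le_min !ge_min lexx orbT andbT.
  by rewrite ler_wpM2r ?invr_ge0.
case: c; apply: mono => //.
  have -> : 15 * n%:R * N%:R * (ln N%:R + 4 / 5 * (L / n%:R))
      = 15 * (n%:R * N%:R * ln N%:R) + 12 * N%:R * L by field.
  lra.
have -> : 13 * n%:R * N%:R * (ln N%:R + 12 / 13 * (L / n%:R))
    = 13 * (n%:R * N%:R * ln N%:R) + 12 * N%:R * L by field.
lra.
Qed.

(** Take for [W] the footprints of the parts of an optimal partitioning: each edge of [X] lies
    inside the footprint of its own part. *)
Lemma opt_footprint_small_uncovered c (X : {set {set 'I_n}}) : (0 < N)%N -> X \subset hyperedges c n d ->
    (opt_footprint N X)%:R < footprint_lower_bound R c n d N ->
  exists2 W : {ffun 'I_N -> {set 'I_n}},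
    [forall b, #|W b|%:R < footprint_lower_bound R c n d N] &
    [disjoint X & hyperedges c n d :&: uncovered W].
Proof.
move=> N_gt0 XA; have [Phi XPhi ->] := opt_footprint_attained X N_gt0 => opt_lt.
exists [ffun b => cover (Phi b)].
  apply/forallP => b; rewrite ffunE; apply: le_lt_trans opt_lt.
  by rewrite ler_nat; exact: leq_bigmax.
have /andP[_ /eqP <-] := XPhi; rewrite disjoint_subset; apply/subsetP => e.
move=> /bigcupP[b _ eb]; rewrite !inE negb_and; apply/orP; right.
apply/forallPn; exists b; rewrite negbK ffunE.
exact: bigcup_sup.
Qed.

Lemma prod_compl_le_expR (T : finType) (U : {set T}) (phi : T -> R) (p : R) :
    (forall e, e \in U -> p <= phi e <= 1) ->
  \prod_(e in U) (1 - phi e) <= expR (- p * #|U|%:R).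
Proof.
move=> phi_ge; rewrite expRM_natr -prodr_const; apply: ler_prod => e eU.
have /andP[pe e1] := phi_ge e eU; rewrite subr_ge0 e1 /=.
by apply: le_trans (expR_ge1Dx _); lra.
Qed.

Lemma opt_footprint_converse c M (z : R) (phi : {set 'I_n} -> R) :
    (1 < N)%N -> (2 * d <= n)%N -> (2 * M ^ 2 <= n * d)%N -> (N <= 'C(M, d))%N ->
    1 <= z ->
    (forall e, e \in hyperedges c n d -> phi_min c n d N z <= phi e <= 1) ->
  1 - 1 / n%:R `^ z <=
    random_subset_prob (hyperedges c n d) phi
      (fun X => footprint_lower_bound R c n d N <= (opt_footprint N X)%:R).
Proof.
move=> N_gt1 d_le M_le N_le z_ge1 phi_ge; have N_gt0 := ltnW N_gt1.
set A := hyperedges c n d in phi_ge *.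
have A_gt0 : (0 < #|A|)%N.
  rewrite card_hyperedges; have : (0 < 'C(n, d))%N by rewrite bin_gt0; lia.
  by case: (c) => // Cnd; rewrite big_nat_recr //=; lia.
pose K : R := 13 * n%:R * N%:R * ln N%:R + 12 * N%:R * (ln 2 + z * ln n%:R).
have ln2 : 0 < ln 2 :> R by rewrite ln_gt0 // ltr1n.
have ln2N : ln 2 <= ln N%:R :> R by rewrite ler_ln ?posrE ?ltr0n // ler_nat.
have lnn : 0 <= ln n%:R :> R by rewrite ln_ge0 // ler1n.
have zlnn : 0 <= z * ln n%:R :> R by rewrite mulr_ge0 // (le_trans ler01).
have N_ge1 : 1 <= N%:R :> R by rewrite ler1n.
have n_ge1 : 1 <= n%:R :> R by rewrite ler1n.
(* A sixth of [K] dominates the logarithm of [2 ^ (n N) * n ^ z]; the comparison [ln 2 <= ln N] uses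
   [N >= 2]. *)
have K_ge : 6 * (n%:R * N%:R * ln 2 + z * ln n%:R) <= K.
  have h1 : n%:R * N%:R * ln 2 <= n%:R * N%:R * ln N%:R :> R.
    by rewrite ler_wpM2l ?mulr_ge0.
  have h2 : z * ln n%:R <= N%:R * (ln 2 + z * ln n%:R) by nra.
  have h3 : 0 <= n%:R * N%:R * ln 2 :> R by rewrite !mulr_ge0 // ltW.
  rewrite /K -!mulrA; rewrite -!mulrA in h1 h3; lra.
have K_ge0 : 0 <= K.
  by apply: le_trans K_ge; rewrite mulr_ge0 // addr_ge0 // !mulr_ge0 // ltW.
have {}phi_ge e : e \in A -> Num.min (K / #|A|%:R) 1 <= phi e <= 1.
  move=> /phi_ge/andP[le_phi ->]; rewrite andbT.
  exact: le_trans (phi_min_lower_bound c N_gt0 z_ge1) le_phi.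
have phi01 e : e \in A -> 0 <= phi e <= 1.
  move=> /phi_ge/andP[le_phi ->]; rewrite andbT; apply: le_trans le_phi.
  by rewrite le_min ler01 divr_ge0.
rewrite random_subset_prob_compl lerB //.
pose small (W : {ffun 'I_N -> {set 'I_n}}) :=
  [forall b, #|W b|%:R < footprint_lower_bound R c n d N].
apply: le_trans (random_subset_union_bound phi01 (P := small)
  (F := fun W X => [disjoint X & A :&: uncovered W]) _) _.
  move=> X XA /=; rewrite -ltNge; exact: opt_footprint_small_uncovered.
(* [q] is [n ^ (- z)] divided by the number [2 ^ (n N)] of all tuples, so the union bound sums to at
   most [n ^ (- z)]. *)
pose q : R := expR (- (n%:R * N%:R * ln 2 + z * ln n%:R)).
have le_q W : small W ->
    random_subset_prob A phi (fun X => [disjoint X & A :&: uncovered W]) <= q.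
  move=> /forallP smallW; rewrite random_subset_prob_disjoint ?subsetIl //.
  have := card_uncovered N_gt1 d_le M_le N_le smallW.
  rewrite -/A; set U := A :&: _ => le_AU.
  have UA e : e \in U -> e \in A by rewrite inE => /andP[].
  have [K_lt | K_gt] := leP (K / #|A|%:R) 1; last first.
    (* Here the lower bound on [phi] is capped at 1: every hyperedge is surely present, and a single
       uncovered one makes the product vanish. *)
    have /card_gt0P[e eU] : (0 < #|U|)%N.
      by rewrite -(ltn_pmul2l (isT : 0 < 6)%N) muln0 (leq_trans A_gt0).
    rewrite (bigD1 e) //=.
    have := phi_ge e (UA e eU); rewrite min_r ?(ltW K_gt) // => /le_anti <-.
    by rewrite subrr mul0r expR_ge0.
  apply: (le_trans (@prod_compl_le_expR _ _ _ (K / #|A|%:R) _)).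
    by move=> e /UA/phi_ge; rewrite min_l.
  rewrite ler_expR mulNr lerN2 -(ler_pM2l (x := 6)) //.
  apply: le_trans K_ge _.
  have -> : 6 * (K / #|A|%:R * #|U|%:R) = K * ((6 * #|U|)%:R / #|A|%:R).
    by rewrite natrM; ring.
  by rewrite ler_peMr // ler_pdivlMr ?ltr0n // mul1r ler_nat.
apply: le_trans (ler_sum _ le_q) _; rewrite sumr_const.
apply: (@le_trans _ _ (q *+ #|{ffun 'I_N -> {set 'I_n}}|)).
  by rewrite ler_wpMn2l ?expR_ge0 // max_card.
rewrite card_ffun card_ord -cardsT -powersetT card_powerset cardsT card_ord.
rewrite -[leLHS]mulr_natl !natrX -(lnK (x := 2)) ?posrE // -!expRM_natr -expRD.
rewrite div1r /powR gt_eqF ?ltr0n // -expRN ler_expR; lra.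
Qed.

End Converse.

(** * Achievability of the interweaved-cliques design *)

Section Cut.
Local Open Scope nat_scope.
Context {T : eqType}.
Implicit Types (m i j : nat) (L : seq T).

Lemma flatten_cut m L : 0 < m -> flatten (Defs.cut m L) = L.
Proof.
move=> m_gt0; rewrite reshapeKr // sumn_cat !sumn_nseq.
by have := divn_eq (size L) m; have := ltn_pmod (size L) m_gt0; nia.
Qed.

Lemma size_cut m L : 0 < m -> size (Defs.cut m L) = m.
Proof.
move=> m_gt0; rewrite size_reshape size_cat !size_nseq subnKC //.
by rewrite ltnW // ltn_pmod.
Qed.

Lemma mem_nth_cut m L i : {subset nth [::] (Defs.cut m L) i <= L}.
Proof. by move=> x; rewrite nth_reshape => /mem_take/mem_drop. Qed.

Lemma mem_cut m L x : 0 < m -> x \in L ->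
  exists2 i, i < m & x \in nth [::] (Defs.cut m L) i.
Proof.
move=> m_gt0; rewrite -{1}(flatten_cut L m_gt0) => /flattenP[l lL xl].
by exists (index l (Defs.cut m L)); rewrite ?nth_index // -[ltnRHS](size_cut L m_gt0) index_mem.
Qed.

(** The positions need no range condition, since the default [[::]] has no members. *)
Lemma uniq_flatten_nth (ss : seq (seq T)) x i j : uniq (flatten ss) ->
  x \in nth [::] ss i -> x \in nth [::] ss j -> i = j.
Proof.
have nth_flatten k r : x \in nth [::] r k -> x \in flatten r.
  have [kr xk|kr] := ltnP k (size r); last by rewrite nth_default.
  by apply/flattenP; exists (nth [::] r k) => //; exact: mem_nth.
elim: ss i j => [|s ss IHss] [|i] [|j] //=; rewrite cat_uniq.
- by move=> /and3P[_ /hasPn nos _] xs /nth_flatten/nos; rewrite xs.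
- by move=> /and3P[_ /hasPn nos _] /nth_flatten/nos/negP.
- by move=> /and3P[_ _ uss] xi xj; rewrite (IHss i j).
Qed.

Lemma nth_cut_inj m L x i j : 0 < m -> uniq L ->
  x \in nth [::] (Defs.cut m L) i -> x \in nth [::] (Defs.cut m L) j -> i = j.
Proof. by move=> m_gt0 uL; apply: uniq_flatten_nth; rewrite flatten_cut. Qed.

End Cut.

Section LexEnum.
Local Open Scope nat_scope.
Context {m : nat}.
Implicit Type S : {set {set 'I_m}}.

Lemma mem_lex_enum S : lex_enum S =i S.
Proof. by move=> e; rewrite mem_sort mem_enum. Qed.

Lemma lex_enum_uniq S : uniq (lex_enum S).
Proof. by rewrite sort_uniq enum_uniq. Qed.

Lemma size_lex_enum S : size (lex_enum S) = #|S|.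
Proof. by rewrite size_sort cardE. Qed.

End LexEnum.

Lemma exists_ksubset_superset m k (I : {set 'I_m}) :
    (#|I| <= k)%N -> (k <= m)%N ->
  exists2 sigma, sigma \in ksubsets m k & I \subset sigma.
Proof.
move=> Ik km; have : (0 < 'C(#|~: I|, k - #|I|))%N.
  by rewrite bin_gt0; have := cardsC I; rewrite card_ord => E; lia.
rewrite -cards_draws => /card_gt0P[B]; rewrite inE => /andP[BI /eqP cB].
exists (I :|: B); last exact: subsetUl.
rewrite inE cardsU cB (_ : I :&: B = set0) ?cards0 ?subn0 ?subnKC //.
by apply/eqP; rewrite setI_eq0 disjoint_sym disjoints_subset.
Qed.

(** * The design yields a partitioning, and its footprints miss many vertices *)

Section InterweavedCliques.
Local Open Scope nat_scope.
Variables n d N : nat.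
Hypotheses (d_gt0 : 0 < d) (N_gt0 : 0 < N).

Local Notation f := (IC_f d N).
Local Notation s := (IC_s n d N).
Implicit Types (e : {set 'I_n}) (sigma : {set 'I_f}) (X : {set {set 'I_n}}).

Lemma IC_f_ge_d : d <= f.
Proof. by apply: IC_f_max => //; rewrite binn. Qed.

Lemma IC_family_inj (v : 'I_n) (i j : 'I_f) :
  v \in IC_family n i -> v \in IC_family n j -> i = j.
Proof.
rewrite !inE => /andP[iv vi] /andP[jv vj]; apply/val_inj => /=.
by case: (ltngtP i j) => // ij; have := leq_mul ij (leqnn s); lia.
Qed.

(** Pick a vertex of [e] in each family it meets; the families are disjoint, so the choice is
    injective. *)
Lemma card_IC_trace e : #|IC_trace d N e| <= #|e|.
Proof.
pose h (j : 'I_f) := [pick v in e :&: IC_family n j].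
have hP j : j \in IC_trace d N e -> exists2 v, h j = Some v & v \in e :&: IC_family n j.
  rewrite inE /h => /set0Pn[v0 v0e]; case: pickP => [v ve|/(_ v0)]; first by exists v.
  by rewrite v0e.
rewrite -(card_in_imset (f := h)) => [|i j /hP[v -> vi] /hP[v' -> vj] [E]].
  rewrite -(card_imset e (@Some_inj _)); apply/subset_leq_card/subsetP => o.
  move=> /imsetP[j /hP[v -> /setIP[ve _]] ->]; exact: imset_f.
move: vi vj; rewrite -E !in_setI => /andP[_ vi] /andP[_ vj].
exact: IC_family_inj vi vj.
Qed.

Lemma mem_IC_block k (I sigma : {set 'I_f}) e :
  e \in IC_block n k I sigma -> #|e| = k /\ IC_trace d N e = I.
Proof.
by rewrite inE => /mem_nth_cut; rewrite mem_lex_enum !inE => /andP[/eqP -> /eqP].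
Qed.

Lemma mem_IC_old_group k sigma e : e \in IC_old_group n k sigma ->
  [/\ #|e| = k, IC_trace d N e \subset sigma &
      e \in IC_block n k (IC_trace d N e) sigma].
Proof.
move=> /bigcupP[I /andP[_ Isigma] eI]; have [ek eI'] := mem_IC_block eI.
by rewrite eI'.
Qed.

Lemma mem_IC_supersets (I sigma : {set 'I_f}) :
  (sigma \in IC_supersets I) = (sigma \in ksubsets f d) && (I \subset sigma).
Proof. by rewrite mem_lex_enum inE. Qed.

(** The trace [I] of [e] satisfies [#|I| <= #|e| <= d <= f], so it has [d]-supersets, and the block
    containing [e] goes to one of them. *)
Lemma IC_old_group_cover e : #|e| <= d ->
  exists2 sigma, sigma \in ksubsets f d & e \in IC_old_group n #|e| sigma.
Proof.
move=> ed; set I := IC_trace d N e; have Ie : #|I| <= #|e| := card_IC_trace e.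
have [sigma0 sigma0P Isigma0] := exists_ksubset_superset (leq_trans Ie ed) IC_f_ge_d.
have S_gt0 : 0 < size (IC_supersets I).
  by rewrite -has_predT; apply/hasP; exists sigma0; rewrite // mem_IC_supersets sigma0P.
have eQ : e \in lex_enum (IC_Q n #|e| I) by rewrite mem_lex_enum !inE !eqxx.
have [j jS ej] := mem_cut S_gt0 eQ.
have := mem_nth set0 jS; rewrite mem_IC_supersets => /andP[sigmaP Isigma].
exists (nth set0 (IC_supersets I) j) => //; apply/bigcupP; exists I.
  by rewrite Ie.
by rewrite inE index_uniq ?lex_enum_uniq.
Qed.

(** The trace of [e] determines the list that is cut, and the blocks of one cut are disjoint. *)
Lemma IC_old_group_inj k sigma sigma' e :
    sigma \in ksubsets f d -> sigma' \in ksubsets f d ->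
    e \in IC_old_group n k sigma -> e \in IC_old_group n k sigma' ->
  sigma = sigma'.
Proof.
move=> sigmaP sigmaP' /mem_IC_old_group[_ Isigma eb] /mem_IC_old_group[_ Isigma' eb'].
set I := IC_trace d N e in Isigma Isigma' eb eb'.
have sigmaS : sigma \in IC_supersets I by rewrite mem_IC_supersets sigmaP.
have sigmaS' : sigma' \in IC_supersets I by rewrite mem_IC_supersets sigmaP'.
have S_gt0 : 0 < size (IC_supersets I) by case: (IC_supersets I) sigmaS.
move: eb eb'; rewrite !inE => eb eb'.
rewrite -(nth_index set0 sigmaS) -(nth_index set0 sigmaS').
by rewrite (nth_cut_inj S_gt0 (lex_enum_uniq _) eb eb').
Qed.

Local Notation N' := 'C(f, d).
Local Notation cliques := (lex_enum (ksubsets f d)).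
Local Notation clique c := (nth set0 cliques (c %% N')).

Lemma IC_cliques_gt0 : 0 < N'.
Proof. by rewrite bin_gt0 IC_f_ge_d. Qed.

Lemma size_cliques : size cliques = N'.
Proof. by rewrite size_lex_enum card_draws card_ord. Qed.

Lemma mem_clique c : clique c \in ksubsets f d.
Proof. by rewrite -mem_lex_enum mem_nth // size_cliques ltn_pmod // IC_cliques_gt0. Qed.

Lemma IC_new_group_sub k (c : 'I_N) :
  IC_new_group n d k c \subset IC_old_group n k (clique c).
Proof. by apply/subsetP => e; rewrite inE => /andP[]. Qed.

Lemma IC_new_group_cover e : #|e| <= d ->
  exists c : 'I_N, e \in IC_new_group n d #|e| c.
Proof.
move=> /IC_old_group_cover[sigma sigmaP esigma]; have N'_gt0 := IC_cliques_gt0.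
set G := IC_old_group n #|e| sigma in esigma.
pose b := index sigma cliques; pose s_b := N %/ N' + (b < N %% N').
pose b' := index e (lex_enum G) %% s_b.
have b_lt : b < N' by rewrite -size_cliques index_mem mem_lex_enum.
have N'N : N' <= N := IC_fP N d_gt0.
have q_gt0 : 0 < N %/ N' by rewrite divn_gt0.
have b'_lt : b' < s_b by rewrite ltn_pmod // addn_gt0 q_gt0.
(* The additional sub-part exists only when [b < N %% N'], which is exactly when its index still
   lies below [N]. *)
have c_lt : b + b' * N' < N.
  move: b'_lt (divn_eq N N'); rewrite /s_b; case: (ltnP b (N %% N')) => br /=; nia.
have cb : (b + b' * N') %% N' = b by rewrite addnC modnMDl modn_small.
exists (Ordinal c_lt); rewrite inE /= cb nth_index ?mem_lex_enum // -/G esigma /=.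
by rewrite [X in _ == X %/ _]addnC divnMDl // (divn_small b_lt) addn0.
Qed.

(** The remainder of [c] modulo [N'] is fixed by the old group of [e], and the quotient by the
    round-robin position of [e] in it. *)
Lemma IC_new_group_inj k (c c' : 'I_N) e :
  e \in IC_new_group n d k c -> e \in IC_new_group n d k c' -> c = c'.
Proof.
move=> ec ec'; have := IC_old_group_inj (mem_clique c) (mem_clique c')
  (subsetP (IC_new_group_sub k c) _ ec) (subsetP (IC_new_group_sub k c') _ ec').
move=> /(congr1 (index^~ cliques)).
rewrite !index_uniq ?lex_enum_uniq ?size_cliques ?ltn_pmod ?IC_cliques_gt0 // => cc'.
move: ec ec'; rewrite !inE cc' => /andP[_ /eqP qc] /andP[_ /eqP qc'].
by apply/val_inj => /=; rewrite (divn_eq c N') (divn_eq c' N') -qc -qc' cc'.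
Qed.

(** The groups for layer [k] contain only [k]-sets, so in the union over [k] only [k = #|e|]
    matters. *)
Lemma mem_IC_group c (b : 'I_N) e : e \in hyperedges c n d ->
  (e \in IC_group n d c b) = (e \in IC_new_group n d #|e| b).
Proof.
case: c => /=; first by rewrite inE => /eqP ->.
rewrite -/(hyperedges NonUniform n d) mem_hyperedges_NonUniform => /andP[e_gt0 ed].
rewrite big_geq_mkord; apply/bigcupP/idP => [[k k_gt0 ek]|ee]; last first.
  by exists (Ordinal (ed : #|e| < d.+1)).
by have [-> _ _] := mem_IC_old_group (subsetP (IC_new_group_sub k b) _ ek).
Qed.

Lemma card_hyperedge_le c e : e \in hyperedges c n d -> #|e| <= d.
Proof.
case: c; first by rewrite inE => /eqP->.
by rewrite mem_hyperedges_NonUniform => /andP[].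
Qed.

Lemma IC_partitionP c X : X \subset hyperedges c n d ->
  edge_partitioning X (IC_partition d N c X).
Proof.
move=> /subsetP XA; apply/andP; split.
  apply/forallP => b; apply/forallP => b'; apply/implyP; apply: contraR.
  move=> /pred0Pn[e /=]; rewrite !ffunE !in_setI => /andP[/andP[eb eX] /andP[eb' _]].
  move: eb eb'; rewrite !mem_IC_group ?XA // => eb eb'.
  by rewrite (IC_new_group_inj eb eb').
rewrite eqEsubset; apply/andP; split.
  by apply/bigcupsP => b _; rewrite ffunE subsetIr.
apply/subsetP => e eX; have [b eb] := IC_new_group_cover (card_hyperedge_le (XA _ eX)).
by apply/bigcupP; exists b => //; rewrite ffunE in_setI eX mem_IC_group ?XA // eb.
Qed.

Lemma IC_max_footprint c X : X \subset hyperedges c n d -> f * s <= n ->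
  max_footprint (IC_partition d N c X) + (f - d) * s <= n.
Proof.
move=> /subsetP XA fs_le.
have ds_le : (f - d) * s <= n by apply: leq_trans fs_le; rewrite leq_mul2r leq_subr orbT.
suff : max_footprint (IC_partition d N c X) <= n - (f - d) * s by lia.
apply/bigmax_leqP => b _; set sigma := clique b.
(* [h] sends a family and an offset to the vertex there; [f * s <= n] keeps it in range, and
   injectivity counts the [(f - d) * s] vertices in families outside [sigma]. *)
have h_lt (p : 'I_f * 'I_s) : p.1 * s + p.2 < n.
  apply: leq_trans fs_le; have := leq_mul (ltn_ord p.1) (leqnn s).
  by have := ltn_ord p.2; lia.
pose h p := Ordinal (h_lt p).
have h_inj : injective h.
  move=> [i u] [j v] /(congr1 val) /= E; have s_gt0 := leq_ltn_trans (leq0n _) (ltn_ord u).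
  congr (_, _); apply/val_inj => /=.
    by have /= := congr1 (divn^~ s) E; rewrite !divnMDl // !divn_small ?addn0.
  by have /= := congr1 (modn^~ s) E; rewrite !modnMDl !modn_small.
have h_fam i u : h (i, u) \in IC_family n i.
  by rewrite inE /= leq_addr /= mulSn addnC ltn_add2r.
have card_h : #|h @: setX (~: sigma) setT| = (f - d) * s.
  rewrite card_imset // cardsX cardsT card_ord; congr (_ * _).
  have /eqP sigma_d : #|sigma| == d by have := mem_clique b; rewrite inE.
  have := cardsC sigma; rewrite card_ord sigma_d => /(canRL (addKn d)).
  exact.
(* A footprint vertex in a family outside [sigma] would put that family into the trace of its edge,
   which is included in [sigma]. *)
have : cover (IC_partition d N c X b) \subset ~: (h @: setX (~: sigma) setT).
  apply/subsetP => v /bigcupP[e]; rewrite ffunE in_setI => /andP[eb /XA eA] ve.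
  move: eb; rewrite mem_IC_group // => /(subsetP (IC_new_group_sub _ _)).
  move=> /mem_IC_old_group[_ /subsetP trace_e _]; rewrite in_setC.
  apply/imsetP => -[[i u]]; rewrite in_setX in_setC => /andP[/negP i_sigma _] vh.
  apply/i_sigma/trace_e; rewrite inE; apply/set0Pn; exists v.
  by rewrite in_setI ve vh h_fam.
have := cardsC (h @: setX (~: sigma) setT).
rewrite card_h card_ord => /(canRL (addKn _)) <-.
exact: subset_leq_card.
Qed.

End InterweavedCliques.

(** * Numerical bounds on the footprint of the design *)

Section Achievability.
Variables n d N M : nat.
Hypotheses (d_gt0 : (0 < d)%N) (N_gt0 : (0 < N)%N).
Hypotheses (M_le : (2 * M ^ 2 <= n * d)%N) (N_le : (N <= 'C(M, d))%N).

Local Notation f := (IC_f d N).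
Local Notation s := (IC_s n d N).

(** If [f > M], then ['C(M.+1, d) <= 'C(f, d) <= N <= 'C(M, d)], contradicting strict growth of the
    binomial for [d <= M]. *)
Lemma IC_f_sqr_le : (2 * f ^ 2 <= n * d)%N.
Proof.
suff fM : (f <= M)%N.
  by apply: leq_trans M_le; rewrite leq_mul2l leq_exp2r.
rewrite leqNgt; apply/negP => Mf.
have dM : (d <= M)%N by rewrite -bin_gt0 (leq_trans N_gt0).
have := leq_trans (leq_bin2l d Mf) (leq_trans (IC_fP N d_gt0) N_le).
case: d d_gt0 dM => // d' _ dM; rewrite binS.
by have : (0 < 'C(M, d'))%N; [rewrite bin_gt0 ltnW | lia].
Qed.

(** When [f] does not divide [n], multiplying by [f + d] reduces the claim to
    [f * (f + d) <= n * d], which holds as [f * (f + d) <= 2 * f ^ 2]. *)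
Lemma IC_families_fit : (f * s <= n)%N.
Proof.
have df := IC_f_ge_d d_gt0 N_gt0; have := IC_f_sqr_le; rewrite /IC_s.
case: ifP => [fn _|_ sq]; first by rewrite mulnC divnK.
have qn := leq_trunc_div n (f + d).
rewrite -(@leq_pmul2r (f + d)) ?addn_gt0 ?d_gt0 ?orbT //; nia.
Qed.

(** Compare [d]-th powers: maximality of [f] gives [N <= 'C(f.+1, d) <= f.+1 ^ d / d!]. *)
Lemma root_le_IC_f (R : realType) :
  N%:R `^ (1 / d%:R) * d%:R <= expR 1 * f.+1%:R :> R.
Proof.
set y := _ `^ _; have yd : y ^+ d = N%:R by apply: powR_inv_natK.
have y_ge0 : 0 <= y by apply: powR_ge0.
have N_lt : (N <= 'C(f.+1, d))%N.
  rewrite leqNgt; apply/negP => /ltnW/(IC_f_max d_gt0).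
  by rewrite ltnn.
have bin_le : ('C(f.+1, d) * d`! <= f.+1 ^ d)%N by rewrite bin_ffact ffact_leq_exp.
(* Single term of the exponential series: d ^ d / d! <= e ^ d. *)
have exp_ge : d%:R ^+ d <= expR 1 ^+ d * d`!%:R :> R.
  rewrite -expRM_natr mul1r -ler_pdivrMr ?ltr0n ?fact_gt0 //.
  have := @expR_ge1Dxn R d%:R d.-1 (ler0n _ _); rewrite prednK //; lra.
rewrite -(@ler_pXn2r _ d) ?nnegrE ?mulr_ge0 ?expR_ge0 //.
rewrite !exprMn yd; apply: le_trans (ler_wpM2l (ler0n _ _) exp_ge) _.
rewrite mulrCA ler_wpM2l ?exprn_ge0 ?expR_ge0 // -natrX -natrM ler_nat.
by apply: leq_trans bin_le; rewrite leq_mul2r N_lt orbT.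
Qed.

Lemma IC_footprint_bounds (R : realType) c (X : {set {set 'I_n}}) :
    X \subset hyperedges c n d ->
  let pi_IC : R := (max_footprint (IC_partition d N c X))%:R in
  let t : R := (n %/ (f + d)).+1%:R in
  [/\ (f %| n)%N -> pi_IC <= d%:R * n%:R / f%:R,
      ~~ (f %| n)%N -> pi_IC <= n%:R - (f%:R - d%:R) * t /\
        n%:R - (f%:R - d%:R) * t <= 2 * d%:R * t &
      pi_IC <= 4 * expR 1 * (n%:R / N%:R `^ (1 / d%:R))].
Proof.
move=> XA pi_IC t; have df := IC_f_ge_d d_gt0 N_gt0.
have f_gt0 : (0 < f)%N := leq_trans d_gt0 df.
have fR : 0 < f%:R :> R by rewrite ltr0n.
have pi_le : pi_IC + (f%:R - d%:R) * s%:R <= n%:R.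
  by rewrite -natrB // -natrM -natrD ler_nat IC_max_footprint // IC_families_fit.
have y_gt0 : 0 < N%:R `^ (1 / d%:R) :> R by rewrite powR_gt0 ?ltr0n.
have := root_le_IC_f R; set y := _ `^ _ in y_gt0 * => y_le.
have e_gt0 : 0 < expR 1 :> R := expR_gt0 1.
have ef1 : expR 1 * f.+1%:R <= expR 1 * (f + d)%:R :> R.
  by rewrite ler_wpM2l ?expR_ge0 // ler_nat; lia.
have bound_dvd : (f %| n)%N -> pi_IC <= d%:R * n%:R / f%:R.
  move=> fn; have ns : n%:R = f%:R * s%:R :> R.
    by rewrite /IC_s fn -natrM mulnC divnK.
  have -> : d%:R * n%:R / f%:R = d%:R * s%:R :> R.
    by rewrite ns mulrCA mulrAC divff ?mul1r // gt_eqF.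
  by rewrite ns in pi_le; lra.
have bound_ndvd : ~~ (f %| n)%N -> pi_IC <= n%:R - (f%:R - d%:R) * t /\
        n%:R - (f%:R - d%:R) * t <= 2 * d%:R * t.
  move=> fn; move: pi_le; rewrite /IC_s (negPf fn) -/t => pi_le; split; first lra.
  have : n%:R <= t * (f + d)%:R.
    by rewrite -natrM ler_nat ltnW // ltn_ceil // addn_gt0 f_gt0.
  by rewrite natrD; lra.
split=> //; rewrite mulrA ler_pdivlMr //.
have n_ge0 : 0 <= n%:R :> R by [].
have [fn|fn] := boolP (f %| n)%N.
  apply: le_trans (ler_wpM2r (ltW y_gt0) (bound_dvd fn)) _.
  have -> : d%:R * n%:R / f%:R * y = n%:R / f%:R * (y * d%:R) by ring.
  have h : y * d%:R <= 4 * expR 1 * f%:R.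
    apply: le_trans y_le _; apply: le_trans ef1 _.
    rewrite natrD; have : d%:R <= f%:R :> R by rewrite ler_nat.
    nra.
  apply: le_trans (ler_wpM2l _ h) _; first by rewrite divr_ge0.
  rewrite le_eqVlt; apply/orP; left; apply/eqP.
  by field; rewrite gt_eqF.
have [pi1 pi2] := bound_ndvd fn; have pi3 := le_trans pi1 pi2.
(* Cancel [f] in [2 * f ^ 2 <= n * d <= n * f]; then rounding up in [t] costs at most
   [f + d <= 2 * f <= n]. *)
have f2n : (2 * f <= n)%N.
  rewrite -(leq_pmul2r f_gt0) -mulnA mulnn; apply: leq_trans IC_f_sqr_le _.
  by rewrite leq_mul2l df orbT.
have t_le : t * (f + d)%:R <= 2 * n%:R.
  rewrite -!natrM ler_nat mulSn mul2n -addnn leq_add ?leq_trunc_div //.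
  by apply: leq_trans f2n; rewrite mul2n -addnn leq_add2l.
apply: le_trans (ler_wpM2r (ltW y_gt0) pi3) _.
have -> : 2 * d%:R * t * y = 2 * t * (y * d%:R) by ring.
have h := le_trans y_le ef1.
apply: le_trans (ler_wpM2l _ h) _; first by rewrite mulr_ge0.
have -> : 2 * t * (expR 1 * (f + d)%:R) = 2 * expR 1 * (t * (f + d)%:R) by ring.
have -> : 4 * expR 1 * n%:R = 2 * expR 1 * (2 * n%:R) :> R by ring.
by rewrite ler_wpM2l // mulr_ge0 // ltW.
Qed.

End Achievability.

(* The converse fails for N = 1: with c = Uniform and d = z = 1, X may have only
   about 12 ln (2 n) vertices, which is less than n / 2 for large n. *)
Theorem theorem1 (R : realType) (c : setting) (n d N : nat)
    (n_gt0 : (0 < n)%N) (d_gt0 : (0 < d)%N) (N_gt0 : (0 < N)%N)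
    (d_le : d%:R <= n%:R / 2 :> R)
    (N_le : (N <= 'C(Num.truncn (Num.sqrt (n%:R * d%:R / 2 : R)), d))%N) :
  ((1 < N)%N ->
   forall (z : R) (phi : {set 'I_n} -> R),
     1 <= z ->
     (forall e, e \in hyperedges c n d -> phi_min c n d N z <= phi e <= 1) ->
     1 - 1 / n%:R `^ z <=
       random_subset_prob (hyperedges c n d) phi
         (fun X => footprint_lower_bound R c n d N <= (opt_footprint N X)%:R))
  /\
  (forall X : {set {set 'I_n}}, X \subset hyperedges c n d ->
     let f := IC_f d N in
     let Phi := IC_partition d N c X in
     let pi_IC : R := (max_footprint Phi)%:R in
     let t : R := (n %/ (f + d)).+1%:R in
     [/\ edge_partitioning X Phi,
         (f %| n)%N -> pi_IC <= d%:R * n%:R / f%:R,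
         ~~ (f %| n)%N ->
           pi_IC <= n%:R - (f%:R - d%:R) * t /\
           n%:R - (f%:R - d%:R) * t <= 2 * d%:R * t,
         pi_IC <= 4 * expR 1 * (n%:R / N%:R `^ (1 / d%:R)) &
         pi_IC <= optimality_factor R c * footprint_lower_bound R c n d N]).
Proof.
set M := Num.truncn _ in N_le.
have d_le2 : (2 * d <= n)%N.
  by rewrite -(ler_nat R) natrM; move: d_le; rewrite ler_pdivlMr // mulrC.
have M_le : (2 * M ^ 2 <= n * d)%N.
  have M_le_sqrt : M%:R <= Num.sqrt (n%:R * d%:R / 2) :> R.
    by rewrite truncn_le sqrtr_ge0.
  rewrite -(ler_nat R) natrM natrX natrM mulrC -ler_pdivlMr //.
  rewrite -[leRHS]sqr_sqrtr; last by rewrite divr_ge0 // mulr_ge0.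
  by rewrite lerXn2r // nnegrE ?sqrtr_ge0.
split=> [N_gt1 z phi z_ge1 phi_ge|X XA].
  exact: (opt_footprint_converse n_gt0 d_gt0 N_gt1 d_le2 M_le N_le z_ge1 phi_ge).
move=> f Phi pi_IC t.
have [bound_dvd bound_ndvd bound_root] :=
  IC_footprint_bounds d_gt0 N_gt0 M_le N_le R XA.
split=> //; first exact: IC_partitionP.
apply: le_trans bound_root _; have y_gt0 : 0 < N%:R `^ (1 / d%:R) :> R.
  by rewrite powR_gt0 ?ltr0n.
have s_gt0 : 0 < Num.sqrt 2 :> R by rewrite sqrtr_gt0.
(* In both settings factor times lower bound equals [4 e n / N^(1/d)] exactly. *)
case: (c) => /=; rewrite le_eqVlt; apply/orP; left; apply/eqP.
  by field; rewrite gt_eqF.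
by field; rewrite !gt_eqF.
Qed.
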